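(* Let $n\ge2$, $d=\lfloor(4n-2)/3\rfloor$ and $m=2n+1+3(d-n)$. Consider the fair division instance with $n$ agents and goods $[m]=\{1,\dots,m\}$ in which all agents have the same additive valuation $u$ given by $u(j)=\frac23-\frac{\lceil j/2\rceil}{3n}$ if $1\le j\le2n$ and $u(j)=\frac13$ if $2n<j\le m$. Let $A=(A_1,\dots,A_n)$ be the bundles output by the bag-filling algorithm described in the context on this instance, where $A_k$ is the final content of the $k$-th bag. Then $u(A_n)=1-\frac1{3n}$.
   Context: Bag-filling algorithm. The input is an instance with $n$ agents and goods $[m]$, $m\ge 2n$, with valuations $v_i(1)\ge\dots\ge v_i(m)$. Initialize bags $B_k=\{k,2n-k+1\}$ for $k=1,\dots,n$. Process bags in the order $k=1,\dots,n$: as long as no agent without an assigned bag has value at least $1$ for $B_k$ and there are still unused goods among $2n+1,\dots,m$, add to $B_k$ the unused good of smallest index. As soon as some agent without an assigned bag values $B_k$ at least $1$, assign $B_k$ to an arbitrary such agent and move on to the next bag. If the goods run out and no agent without an assigned bag values $B_k$ at least $1$, the algorithm stops and all remaining bags are left as they are. *)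

(* Defs.v *)
From mathcomp Require Import all_boot all_order all_algebra.
From mathcomp Require Import zify lra.

Set Implicit Arguments.
Unset Strict Implicit.
Unset Printing Implicit Defensive.

Import Order.TTheory GRing.Theory Num.Theory.

Local Open Scope ring_scope.

(* Agents, bags and goods are numbered from 0 here and from 1 in the usual
   presentation: g : 'I_m is the good g.+1, k : 'I_n is the bag B_(k.+1). *)
Section BagFilling.

Variables (R : realFieldType) (n m : nat).

(* An additive valuation is given by its values on single goods. *)
Definition bundle_value (w : 'I_m -> R) (B : {set 'I_m}) : R :=
  \sum_(g in B) w g.

Variable v : 'I_n -> 'I_m -> R.

Definition ordered_instance : Prop :=
  (2 * n <= m)%N /\
  forall (i : 'I_n) (g h : 'I_m), (g <= h)%N -> v i h <= v i g.

Record state := State {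
  cur   : nat;                         (* bags with number < cur are assigned *)
  bags  : {ffun 'I_n -> {set 'I_m}};
  alloc : {ffun 'I_n -> option 'I_n}   (* agent |-> the bag assigned to it *)
}.

(* In 1-based numbering, B_K = {K, 2n - K + 1} with K = k.+1. *)
Definition init_bag (k : 'I_n) : {set 'I_m} :=
  [set g : 'I_m | (g.+1 == k.+1)%N || (g.+1 == 2 * n - k.+1 + 1)%N].

Definition init_state : state :=
  State 0 [ffun k => init_bag k] [ffun=> None].

Definition unused (s : state) : {set 'I_m} :=
  [set g : 'I_m | (2 * n < g.+1)%N && [forall k, g \notin bags s k]].

Definition willing (s : state) (k : 'I_n) : {set 'I_n} :=
  [set i : 'I_n | (alloc s i == None) && (1 <= bundle_value (v i) (bags s k))].

Definition add_good (s : state) (k : 'I_n) (g : 'I_m) : state :=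
  State (cur s)
        [ffun k' => if k' == k then g |: bags s k' else bags s k']
        (alloc s).

Definition assign (s : state) (k i : 'I_n) : state :=
  State (cur s).+1
        (bags s)
        [ffun i' => if i' == i then Some k else alloc s i'].

(* The relation is not functional: any willing agent may receive the bag. *)
Inductive step (s : state) : state -> Prop :=
| StepAssign (k i : 'I_n) of
    cur s = k & i \in willing s k : step s (assign s k i)
| StepAdd (k : 'I_n) (g : 'I_m) of
    cur s = k & willing s k = set0 &
    g \in unused s & (forall h, h \in unused s -> (g <= h)%N) :
    step s (add_good s k g).

Inductive halted (s : state) : Prop :=
| HaltDone of cur s = n
| HaltStuck (k : 'I_n) of
    cur s = k & willing s k = set0 & unused s = set0.

Inductive reachable : state -> Prop :=
| ReachInit : reachable init_state
| ReachStep (s s' : state) of reachable s & step s s' : reachable s'.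

Definition bag_filling_output (A : {ffun 'I_n -> {set 'I_m}}) : Prop :=
  exists s : state, [/\ reachable s, halted s & A = bags s].

Lemma bag_filling_terminates : exists A, bag_filling_output A.
Proof.
suff H N (s : state) : reachable s -> (cur s <= n)%N ->
    (n - cur s + #|unused s| < N)%N -> exists A, bag_filling_output A.
  by apply: (H _ init_state ReachInit (leq0n n)); apply: ltnSn.
elim: N s => [//|N IH] s rs; rewrite leq_eqVlt => /orP[/eqP sn _|sn sN].
  by exists (bags s), s; split=> //; apply: HaltDone.
pose k := Ordinal sn.
have [w0|[i iw]] := set_0Vmem (willing s k); last first.
  apply: (IH (assign s k i)); first by apply: ReachStep rs _; apply: StepAssign.
    by [].
  have -> : unused (assign s k i) = unused s by [].
  move: sN => /=; set c := #|_|; lia.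
have [u0|[g0 g0u]] := set_0Vmem (unused s).
  by exists (bags s), s; split=> //; apply: (@HaltStuck s k).
case: (arg_minnP (fun g : 'I_m => val g) g0u) => g gu gmin.
apply: (IH (add_good s k g)); first by apply: ReachStep rs _; apply: StepAdd.
  exact: ltnW.
suff : (#|unused (add_good s k g)| < #|unused s|)%N
  by move: sN => /=; set a := #|_|; set b := #|_|; lia.
apply: proper_card; apply/properP; split.
  apply/subsetP=> h; rewrite !inE => /andP[-> /forallP hu] /=.
  apply/forallP=> k'; have := hu k'; rewrite ffunE.
  by case: ifP => // _; rewrite inE negb_or => /andP[].
exists g => //; rewrite inE negb_and; apply/orP; right.
by rewrite negb_forall; apply/existsP; exists k; rewrite ffunE eqxx !inE eqxx.
Qed.

End BagFilling.

(* j is the 1-based number of a good; uphalf j is the ceiling of j / 2. *)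
Definition tight_value (R : realFieldType) (n j : nat) : R :=
  if (j <= 2 * n)%N then 2 / 3 - (uphalf j)%:R / (3 * n%:R) else 1 / 3.

Definition tight_valuation (R : realFieldType) (n m : nat) (g : 'I_m) : R :=
  tight_value R n g.+1.

Lemma tight_ordered (R : realFieldType) (n m : nat) :
  (0 < n)%N -> (2 * n <= m)%N ->
  ordered_instance (fun _ : 'I_n => @tight_valuation R n m).
Proof.
move=> n0 nm; split=> // _ g h gh; rewrite /tight_valuation /tight_value.
have n3 : 0 < 3 * n%:R :> R by rewrite mulr_gt0 ?ltr0n.
case: ifP => hn; case: ifP => gn; last by [].
- rewrite lerD2l lerN2 ler_pM2r ?invr_gt0 // ler_nat; lia.
- lia.
have : (uphalf g.+1)%:R / (3 * n%:R) <= 1 / 3 :> R.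
  rewrite ler_pdivrMr // mulrA mul1r mulVf ?pnatr_eq0 // mul1r ler_nat; lia.
lra.
Qed.

(* Main.v *)
Require Import Defs.
From mathcomp Require Import all_boot all_order all_algebra.
From mathcomp Require Import zify ring.

(** Every initial bag is worth [4/3 - (n+1)/(3n) = 1 - 1/(3n) < 1], so each bag
    that gets assigned must first consume one of the goods beyond [2n].  There
    are only [1 + 3(d-n) <= n-1] of these, so the last bag is never touched. *)

Set Implicit Arguments.
Unset Strict Implicit.
Unset Printing Implicit Defensive.

Import Order.TTheory GRing.Theory Num.Theory.

Local Open Scope ring_scope.

Section UntouchedBags.

Variables (R : realFieldType) (n m : nat) (v : 'I_n -> 'I_m -> R).

Lemma card_unused_init : (#|unused (init_state n m)| <= m - 2 * n)%N.
Proof.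
have -> : (m - 2 * n)%N = #|[set g : 'I_m | (2 * n <= g)%N]|.
  rewrite -sum1_card; under eq_bigl do rewrite inE.
  by rewrite -(big_geq_mkord _ _ (fun=> true) (fun=> 1%N)) sum_nat_const_nat muln1.
by apply/subset_leq_card/subsetP => g; rewrite !inE => /andP[].
Qed.

Lemma card_unused_add_good (s : state n m) (k : 'I_n) (g : 'I_m) :
  g \in unused s -> (#|unused (add_good s k g)| < #|unused s|)%N.
Proof.
move=> gu; apply/proper_card/properP; split.
  apply/subsetP => h; rewrite !inE => /andP[-> /forallP hu] /=.
  apply/forallP => k'; have := hu k'; rewrite ffunE.
  by case: ifP => // _; rewrite inE negb_or => /andP[].
exists g => //; rewrite inE negb_and negb_forall; apply/orP; right.
by apply/existsP; exists k; rewrite ffunE eqxx !inE eqxx.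
Qed.

Hypothesis init_lt1 : forall i k : 'I_n, bundle_value (v i) (init_bag m k) < 1.

Lemma reachable_unused (s : state n m) : reachable v s ->
  (cur s + #|unused s| <= m - 2 * n)%N /\
  forall k : 'I_n, (cur s <= k)%N ->
    bags s k = init_bag m k \/
    (k = cur s :> nat /\ (cur s + #|unused s| < m - 2 * n)%N).
Proof.
elim=> {s} [|s s' _ [le_unused untouched] step_s].
  by split=> [|k _]; [exact: card_unused_init | left; rewrite ffunE].
case: step_s => [k i cur_k | k g cur_k _ gu _].
- rewrite inE => /andP[_ val_ge1].
  (* A bag worth at least 1 is no longer initial, which forces the strict alternative of the
     invariant. *)
  have lt_unused : (cur s + #|unused s| < m - 2 * n)%N.
    have [|bag_k|[]//] := untouched k; first by rewrite cur_k.
    by move: val_ge1; rewrite bag_k leNgt init_lt1.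
  split=> [|k' /= lt_k']; first by rewrite /= addSn.
  have [|bag_k'|[eq_k' _]] := untouched k'; [exact: ltnW | by left |].
  by move: lt_k'; rewrite eq_k' ltnn.
(* One good is used up while [cur] stays fixed. *)
- have lt_unused : (cur s + #|unused (add_good s k g)| < m - 2 * n)%N.
    by apply: leq_trans le_unused; rewrite ltn_add2l card_unused_add_good.
  split=> [|k' le_k']; first exact: ltnW.
  have [->|neq_k'] := eqVneq k' k; first by right.
  have [//|bag_k'|[eq_k' _]] := untouched k'.
    by left; rewrite ffunE (negPf neq_k').
  by case/eqP: neq_k'; apply: val_inj; rewrite /= eq_k'.
Qed.

(** The invariant gives [cur s <= m - 2 * n <= k], so bag [k] is unassigned. Had it been altered, it
    would be the current bag and strictness would give [cur s < k]. *)
Lemma output_untouched (A : {ffun 'I_n -> {set 'I_m}}) (k : 'I_n) :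
  bag_filling_output v A -> (m - 2 * n <= k)%N -> A k = init_bag m k.
Proof.
case=> s [/reachable_unused[le_unused untouched] _ ->] le_k.
have le_cur : (cur s <= k)%N.
  by apply: leq_trans le_k; apply: leq_trans le_unused; apply: leq_addr.
have [//|[eq_k lt_unused]] := untouched k le_cur.
by move: (leq_trans lt_unused le_k); rewrite eq_k ltnNge leq_addr.
Qed.

End UntouchedBags.

Lemma tight_value_init_bag (R : realFieldType) (n m : nat) (k : 'I_n) :
  (2 * n <= m)%N ->
  bundle_value (@tight_valuation R n m) (init_bag m k) = 1 - 1 / (3 * n%:R).
Proof.
move=> le_m; have lt_k := ltn_ord k.
have lt1 : (k < m)%N by lia.
have lt2 : (2 * n - k.+1 < m)%N by lia.
have -> : init_bag m k = [set Ordinal lt1; Ordinal lt2].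
  by apply/setP => g; rewrite !inE -!val_eqE /=; lia.
rewrite /bundle_value big_setU1 /=; last by rewrite inE -val_eqE /=; lia.
rewrite big_set1 /tight_valuation /tight_value /= !ifT; try lia.
(* The 1-based numbers of the two goods sum to [2 * n + 1], so exactly one is odd and their halves,
   rounded up, sum to [n + 1] for every [k]. *)
have : (k./2.+1 + (2 * n - k.+1)./2.+1 = n + 1)%N by lia.
move=> /(congr1 (fun j => j%:R : R)); rewrite !natrD => eq_half.
have n0 : n%:R != 0 :> R by rewrite pnatr_eq0; lia.
rewrite addrACA -opprD -(mulrDl k./2.+1%:R) eq_half; field.
by rewrite n0.
Qed.

Theorem lemma16 (R : realFieldType) (n d m : nat)
  (hn : (2 <= n)%N)
  (hd : d = ((4 * n - 2) %/ 3)%N)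
  (hm : m = (2 * n + 1 + 3 * (d - n))%N)
  (A : {ffun 'I_n -> {set 'I_m}})
  (hA : bag_filling_output (fun _ : 'I_n => @tight_valuation R n m) A)
  (k : 'I_n) (hk : k.+1 = n) :
  bundle_value (@tight_valuation R n m) (A k) = 1 - 1 / (3 * n%:R).
Proof.
have le_m : (2 * n <= m)%N by lia.
(* With [k = n - 1], the bound [m - 2 * n <= k] reads [3 * (d - n) <= n - 2], which follows from
   [3 * d <= 4 * n - 2]. *)
rewrite (output_untouched _ hA) ?tight_value_init_bag //; last by lia.
move=> _ k'; rewrite tight_value_init_bag // gtrBl divr_gt0 //.
by rewrite mulr_gt0 // ltr0n; lia.
Qed.
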